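(* In the restricted cut-and-choose setting described in the context (Protocol 1), assume the expected number of test rounds satisfies $N\ge1$. Let $\varepsilon_H,\varepsilon_D\ge0$ be such that, for the input $\psi=|+\rangle\langle+|^{\otimes k}$ and unitary $U=\mathbb{1}_{\mathcal{X}}$, $$\tfrac12\big\|\rho_H-|+\rangle\langle+|^{\otimes k}\big\|_1\le\varepsilon_H$$ and, for every $\alpha\in\mathbb{R}$ (attack placement fixed as before or after the delegated unitary), $$\min_{p\in[0,1]}\tfrac12\big\|\rho^\alpha_D-\big(p|+\rangle\langle+|^{\otimes k}+(1-p)|\bot\rangle\langle\bot|\big)\big\|_1\le\varepsilon_D .$$ Then $\varepsilon_H+\varepsilon_D\ge\frac{1}{4\sqrt N}$.
   Context: Restricted cut-and-choose setting. Fix $k\ge 1$, $\mathcal{X}=\mathbb{C}^{2^k}$, $P(\alpha)=\mathrm{diag}(1,e^{i\alpha})$, $A_\alpha=\mathbb{1}_2^{\otimes(k-1)}\otimes P(\alpha)$, $|+\rangle=(|0\rangle+|1\rangle)/\sqrt2$, $|+_\alpha\rangle=(|0\rangle+e^{i\alpha}|1\rangle)/\sqrt2$. Let $\Omega$ be a probability distribution on $\mathbb{N}=\{0,1,\dots\}$ (number $n$ of test rounds) with finite mean $N=\sum_n n\Omega(n)$. For each $n$ and $i\in\{1,\dots,n+1\}$ there are a test unitary $T_{n,i}\in\mathrm{U}(\mathcal{X})$ and a test input unit vector $|\chi_{n,i}\rangle\in\mathcal{X}$, and for each $n$ an operator $0\le\mu_{k,n}\le\mathbb{1}$ on $\mathcal{X}^{\otimes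 n}$ (accept outcome). The output round $\ell$ is uniform on $\{1,\dots,n+1\}$, rounds $i\neq\ell$ are test rounds; after all rounds the client measures the $n$ test outputs with $\{\mu_{k,n},\mathbb{1}-\mu_{k,n}\}$, outputs the computation-round output on acceptance and $|\bot\rangle$ otherwise, where $|\bot\rangle$ is a unit vector orthogonal to $\mathcal{X}$. The phase attack with parameter $\alpha$ replaces every delegated unitary $T$ by $T^\alpha=TA_\alpha$ (for all rounds) or by $T^\alpha=A_\alpha T$ (for all rounds). Define $p^H_{n,\ell}=\mathrm{Tr}[\mu_{k,n}\bigotimes_{i\ne\ell}T_{n,i}|\chi_{n,i}\rangle\langle\chi_{n,i}|T_{n,i}^\dagger]$, $p^D_{n,\ell}$ the same with $T_{n,i}$ replaced by $T^\alpha_{n,i}$, $p_H=\sum_n\frac{\Omega(n)}{n+1}\sum_{\ell=1}^{n+1}p^H_{n,\ell}$, $p^\alpha_D=\sum_n\frac{\Omega(n)}{n+1}\sum_{\ell=1}^{n+1}p^D_{n,\ell}$. The client's output states are $\rho_H=p_H|+\rangle\langle+|^{\otimes k}+(1-p_H)|\bot\rangle\langle\bot|$ (honest) and $\rho^\alpha_D=p^\alpha_D|+\rangle\langle+|^{\otimes (k-1)}\otimes|+_\alpha\rangle\langle+_\alpha|+(1-p^\alpha_D)|\bot\rangle\langle\bot|$ (phase attack). These trace-distance conditions are implied by composable $\varepsilon_H$-correctness and $\varepsilon_D$-security with respect to the ideal VDQC resource, which outputs $U(\psi)$ if the server's bit $c=0$ and $\bot$ if $c=1$. *)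

(* Defs.v *)
From HB Require Import structures.
From mathcomp Require Import all_boot all_order all_algebra.
From mathcomp Require Import complex mxtens.
From mathcomp Require Import all_classical all_reals.
From mathcomp Require Import topology normedtype sequences exp trigo.

Set Implicit Arguments.
Unset Strict Implicit.
Unset Printing Implicit Defensive.

Import Order.TTheory GRing.Theory Num.Theory.
Import numFieldNormedType.Exports.
Local Open Scope ring_scope.
Local Open Scope complex_scope.

Section QDefs.
Variable R : realType.
Local Notation C := R[i].

Definition adjmx {m n} (A : 'M[C]_(m, n)) : 'M[C]_(n, m) :=
  (map_mx (fun z : C => z^*%R) A)^T.

Definition ketbra {m} (v : 'cV[C]_m) : 'M[C]_m := v *m adjmx v.

Definition qunitary {m} (U : 'M[C]_m) : Prop := adjmx U *m U = 1%:M.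

Definition qunit_vec {m} (v : 'cV[C]_m) : Prop := adjmx v *m v = 1%:M.

Definition qpsd {m} (A : 'M[C]_m) : Prop :=
  adjmx A = A /\ forall v : 'cV[C]_m, 0 <= (adjmx v *m A *m v) 0 0.

Definition qeffect {m} (A : 'M[C]_m) : Prop := qpsd A /\ qpsd (1%:M - A).

Definition qtrace_norm {m} (A : 'M[C]_m) (t : R) : Prop :=
  exists B : 'M[C]_m, qpsd B /\ B *m B = adjmx A *m A /\ \tr B = t%:C.

Definition trace_dist_le {m} (rho sigma : 'M[C]_m) (eps : R) : Prop :=
  exists t, qtrace_norm (rho - sigma) t /\ t / 2 <= eps.

Fixpoint ntens_rec {m n} (f : nat -> 'M[C]_(m, n)) (k : nat)
  : 'M[C]_(m ^ k.+1, n ^ k.+1) :=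
  if k is k'.+1 then f 0%N *t ntens_rec (fun j => f j.+1) k' else f 0%N.

Definition ntens {m n} (f : nat -> 'M[C]_(m, n)) (k : nat) : 'M[C]_(m ^ k, n ^ k) :=
  if k is k'.+1 return 'M[C]_(m ^ k, n ^ k) then ntens_rec f k' else 1%:M.

Definition ntensv {m} (f : nat -> 'cV[C]_m) (k : nat) : 'cV[C]_(m ^ k) :=
  castmx (erefl (m ^ k)%N, exp1n k) (ntens f k).

Definition expi (a : R) : C := cos a +i* sin a.

Definition Pgate (a : R) : 'M[C]_2 :=
  \matrix_(i < 2, j < 2) (if (i == j) then (if i == 1 :> nat then expi a else 1) else 0).

Definition Aatt (k : nat) (a : R) : 'M[C]_(2 ^ k) :=
  ntens (fun j => if j == k.-1 then Pgate a else 1%:M) k.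

Definition ketplus : 'cV[C]_2 := \col_(i < 2) (Num.sqrt (2^-1 : R))%:C.
Definition ketplusa (a : R) : 'cV[C]_2 :=
  \col_(i < 2) ((Num.sqrt (2^-1 : R))%:C * (if i == 1 :> nat then expi a else 1)).

Definition plusk (k : nat) : 'cV[C]_(2 ^ k) := ntensv (fun _ => ketplus) k.
Definition plusk_a (k : nat) (a : R) : 'cV[C]_(2 ^ k) :=
  ntensv (fun j => if j == k.-1 then ketplusa a else ketplus) k.

(* output space X (+) span{|bot>} *)
Definition embX {k} (v : 'cV[C]_(2 ^ k)) : 'cV[C]_(2 ^ k + 1) := col_mx v 0.
Definition ketbot {k} : 'cV[C]_(2 ^ k + 1) := col_mx 0 1%:M.

(* attacked unitary: b = true : T A_alpha (attack before T);
                     b = false: A_alpha T (attack after T) *)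
Definition attacked (k : nat) (b : bool) (a : R) (U : 'M[C]_(2 ^ k)) :=
  if b then U *m Aatt k a else Aatt k a *m U.

(* Rounds are 0-based: round i in {0..n} for n test rounds; the output round
   is l in {0..n} and the j-th test round (j < n) is round bump l j. *)
Definition pacc (k : nat) (V : nat -> nat -> 'M[C]_(2 ^ k))
  (chi : nat -> nat -> 'cV[C]_(2 ^ k)) (mu : forall n, 'M[C]_((2 ^ k) ^ n))
  (n l : nat) : R :=
  complex.Re (\tr (mu n *m ntens (fun j => ketbra (V n (bump l j) *m chi n (bump l j))) n)).

Definition pavg (k : nat) (Omega : nat -> R) (V : nat -> nat -> 'M[C]_(2 ^ k))
  (chi : nat -> nat -> 'cV[C]_(2 ^ k)) (mu : forall n, 'M[C]_((2 ^ k) ^ n)) : R :=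
  limn (series (fun n : nat => Omega n / n.+1%:R * \sum_(l < n.+1) pacc V chi mu n l)).

Definition pH (k : nat) Omega T chi mu : R := @pavg k Omega T chi mu.
Definition pD (k : nat) Omega T chi mu (b : bool) (a : R) : R :=
  @pavg k Omega (fun n i => attacked b a (T n i)) chi mu.

Definition rhoH (k : nat) (p : R) : 'M[C]_(2 ^ k + 1) :=
  p%:C *: ketbra (embX (plusk k)) + (1 - p)%:C *: ketbra (@ketbot k).
Definition rhoD (k : nat) (p a : R) : 'M[C]_(2 ^ k + 1) :=
  p%:C *: ketbra (embX (plusk_a k a)) + (1 - p)%:C *: ketbra (@ketbot k).

End QDefs.

Arguments Aatt {R}.
Arguments plusk {R}.
Arguments plusk_a {R}.
Arguments rhoH {R}.
Arguments rhoD {R}.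
Arguments ketplus {R}.

(* Main.v *)
Require Import Defs.
From HB Require Import structures.
From mathcomp Require Import all_boot all_order all_algebra.
From mathcomp Require Import complex mxtens.
From mathcomp Require Import all_classical all_reals.
From mathcomp Require Import topology normedtype sequences exp trigo.
From mathcomp Require Import spectral ring lra.
Import Order.TTheory GRing.Theory Num.Theory.
Import numFieldNormedType.Exports.
Local Open Scope ring_scope.
Local Open Scope complex_scope.
Local Open Scope classical_set_scope.

(** Choose the attack angle with [sin^2 (alpha/2) = s^2], [s = 1 / (2 sqrt N)]. On one
    round the attack is [1 + (e^(i alpha) - 1) Q] for a projector [Q], so it turns a unit
    vector into one of squared overlap at least [1 - s^2], and [n] test rounds keep squared
    overlap at least [1 - n s^2]. No effect separates pure states of squared overlap [q] by
    more than [sqrt (1 - q) <= (1 - q) + 1/4], so averaging over [n] gives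
    [p_H - p_D <= N s^2 + 1/4 = 1/2]. Correctness gives [1 - p_H <= eps_H]. The output
    states [|+>] and [|+_alpha>] have squared overlap exactly [1 - s^2], so security gives
    [s p_D <= eps_D] whatever the simulator does. Together,
    [eps_H + eps_D >= s (1/2 - eps_H) + eps_H >= s / 2]. *)

Section Adjoint.
Set Implicit Arguments.
Unset Strict Implicit.
Variable R : realType.
Local Notation C := R[i].

Lemma adjmxE m n (A : 'M[C]_(m, n)) i j : adjmx A i j = (A j i)^*%R.
Proof. by rewrite !mxE. Qed.

Lemma adjmxK m n (A : 'M[C]_(m, n)) : adjmx (adjmx A) = A.
Proof. by apply/matrixP => i j; rewrite !adjmxE conjCK. Qed.

Lemma adjmxM m n p (A : 'M[C]_(m, n)) (B : 'M[C]_(n, p)) :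
  adjmx (A *m B) = adjmx B *m adjmx A.
Proof. by rewrite /adjmx map_mxM trmx_mul. Qed.

Lemma adjmxD m n (A B : 'M[C]_(m, n)) : adjmx (A + B) = adjmx A + adjmx B.
Proof. by apply/matrixP => i j; rewrite !(adjmxE, mxE) rmorphD. Qed.

Lemma adjmxB m n (A B : 'M[C]_(m, n)) : adjmx (A - B) = adjmx A - adjmx B.
Proof. by apply/matrixP => i j; rewrite !(adjmxE, mxE) rmorphB. Qed.

Lemma adjmxZ m n (c : C) (A : 'M[C]_(m, n)) : adjmx (c *: A) = c^*%R *: adjmx A.
Proof. by apply/matrixP => i j; rewrite !(adjmxE, mxE) rmorphM. Qed.

Lemma adjmx1 n : adjmx (1%:M : 'M[C]_n) = 1%:M.
Proof. by apply/matrixP => i j; rewrite adjmxE !mxE rmorph_nat eq_sym. Qed.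

Lemma adjmx_tens m n p q (A : 'M[C]_(m, n)) (B : 'M[C]_(p, q)) :
  adjmx (A *t B) = adjmx A *t adjmx B.
Proof. by rewrite /adjmx map_mxT trmx_tens. Qed.

Lemma conjC_real (a : R) : (a%:C)^*%R = a%:C.
Proof. by apply/CrealP; apply/complex_realP; exists a. Qed.

Definition ip m (x y : 'cV[C]_m) : C := (adjmx x *m y) 0 0.

Lemma ipBl m (x y z : 'cV[C]_m) : ip (x - y) z = ip x z - ip y z.
Proof. by rewrite /ip adjmxB mulmxBl !mxE. Qed.

Lemma ipDr m (x y z : 'cV[C]_m) : ip x (y + z) = ip x y + ip x z.
Proof. by rewrite /ip mulmxDr mxE. Qed.

Lemma ipBr m (x y z : 'cV[C]_m) : ip x (y - z) = ip x y - ip x z.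
Proof. by rewrite /ip mulmxBr !mxE. Qed.

Lemma ipZl m (c : C) (x y : 'cV[C]_m) : ip (c *: x) y = c^*%R * ip x y.
Proof. by rewrite /ip adjmxZ -scalemxAl mxE. Qed.

Lemma ipZr m (c : C) (x y : 'cV[C]_m) : ip x (c *: y) = c * ip x y.
Proof. by rewrite /ip -scalemxAr mxE. Qed.

Lemma ip_mulmxl m n (A : 'M[C]_(m, n)) x y :
  ip (A *m x) y = ip x (adjmx A *m y).
Proof. by rewrite /ip adjmxM mulmxA. Qed.

Lemma ip_conj m (x y : 'cV[C]_m) : (ip x y)^*%R = ip y x.
Proof. by rewrite /ip -adjmxE adjmxM adjmxK. Qed.

Lemma ip_ge0 m (x : 'cV[C]_m) : 0 <= ip x x.
Proof.
by rewrite /ip mxE sumr_ge0 // => i _; rewrite adjmxE mulrC mul_conjC_ge0.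
Qed.

Lemma ip_eq0 m (x : 'cV[C]_m) : ip x x = 0 -> x = 0.
Proof.
rewrite /ip mxE => /eqP; rewrite psumr_eq0 => [/allP x0|i _]; last first.
  by rewrite adjmxE mulrC mul_conjC_ge0.
apply/matrixP => i j; rewrite mxE ord1; apply/eqP.
by have := x0 i (mem_index_enum _); rewrite adjmxE mulrC mul_conjC_eq0.
Qed.

Lemma qunit_vecP m (x : 'cV[C]_m) : qunit_vec x <-> ip x x = 1.
Proof.
split=> [xx|xx]; first by rewrite /ip xx mxE eqxx.
by apply/matrixP => i j; rewrite !ord1 /ip in xx *; rewrite xx mxE.
Qed.

Lemma Re_ge0 (z : C) : 0 <= z -> 0 <= complex.Re z.
Proof. by rewrite lecE => /andP[]. Qed.

Lemma ReD (y z : C) : complex.Re (y + z) = complex.Re y + complex.Re z.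
Proof. by case: y z => [? ?] []. Qed.

Lemma ReB (y z : C) : complex.Re (y - z) = complex.Re y - complex.Re z.
Proof. by case: y z => [? ?] []. Qed.

Lemma ReZ (a : R) (z : C) : complex.Re (a%:C * z) = a * complex.Re z.
Proof. by case: z => x y /=; rewrite mul0r subr0. Qed.

Lemma Re_conj (z : C) : complex.Re (z^*%R) = complex.Re z.
Proof. by case: z. Qed.

Lemma Re_sum (I : finType) (F : I -> C) :
  complex.Re (\sum_i F i) = \sum_i complex.Re (F i).
Proof. by elim/big_rec2: _ => //= i y z _ <-; rewrite ReD. Qed.

Lemma Re_ip_le m (a c : 'cV[C]_m) (b : R) : 0 <= b ->
  complex.Re (ip a a) <= 1 -> ip c c = (b ^+ 2)%:C -> complex.Re (ip a c) <= b.
Proof.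
move=> b0 a1 cc; have [b_eq0|b_neq0] := eqVneq b 0.
  have -> : c = 0 by apply: ip_eq0; rewrite cc b_eq0 expr0n.
  by rewrite /ip mulmx0 mxE b_eq0.
have {b_neq0} b_gt0 : 0 < b by rewrite lt_neqAle eq_sym b_neq0.
have := Re_ge0 (ip_ge0 (b%:C *: a - c)).
rewrite !(ipBl, ipBr) !(ipZl, ipZr) conjC_real cc !ReB !ReZ /=.
rewrite -(ip_conj a c) Re_conj.
by move=> h; rewrite -(ler_pM2l b_gt0); nra.
Qed.

Lemma ketbra_mul m (x y : 'cV[C]_m) : ketbra x *m ketbra y = ip x y *: (x *m adjmx y).
Proof.
rewrite /ketbra mulmxA -(mulmxA x) [adjmx x *m y]mx11_scalar -/(ip x y).
by rewrite mul_mx_scalar -scalemxAl.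
Qed.

Lemma mxtrace_mul_ketbra m (A : 'M[C]_m) x : \tr (A *m ketbra x) = ip x (A *m x).
Proof. by rewrite /ketbra mulmxA mxtrace_mulC /ip /mxtrace big_ord1. Qed.

(* A Hermitian M with M^3 = M has spectrum in {-1, 0, 1}, hence is a contraction. *)
Lemma contraction_of_cube m (M : 'M[C]_m) x : adjmx M = M -> M *m M *m M = M ->
  complex.Re (ip (M *m x) (M *m x)) <= complex.Re (ip x x).
Proof.
move=> Mh M3; rewrite -subr_ge0 -ReB.
suff -> : ip x x - ip (M *m x) (M *m x) = ip (x - M *m (M *m x)) (x - M *m (M *m x)).
  exact/Re_ge0/ip_ge0.
rewrite !(ipBl, ipBr) !ip_mulmxl Mh !mulmxA M3; ring.
Qed.

Lemma qtrace_norm_dual m (A M : 'M[C]_m) t : qtrace_norm A t ->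
  adjmx M = M -> M *m M *m M = M -> complex.Re (\tr (M *m A)) <= t.
Proof.
move=> [B [[Bh Bpos] [BB trB]]] Mh M3.
have Bt : map_mx Num.conj B^T = B by rewrite -[RHS]Bh /adjmx map_trmx.
have /orthomx_spectralP : B \is normalmx by apply/normalmxP; rewrite Bt.
set P := spectralmx B; set d := spectral_diag B => Bd.
have Pu : P \is unitarymx := spectral_unitarymx B.
have PE : invmx P = adjmx P by rewrite invmx_unitary // /adjmx map_trmx.
have PP : P *m adjmx P = 1%:M by rewrite -PE mulmxV // unitarymx_unit.
have P'P : adjmx P *m P = 1%:M by rewrite -PE mulVmx // unitarymx_unit.
pose e i := col i (adjmx P).
have eE (X : 'M[C]_m) i : ip (e i) (X *m e i) = (P *m X *m adjmx P) i i.
  have -> : ip (e i) (X *m e i) = (row i P *m col i (X *m adjmx P)) 0 0.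
    congr ((_ *m _) 0 0); last by rewrite /e !colE mulmxA.
    by apply/matrixP => j l; rewrite adjmxE !mxE conjCK.
  rewrite mxE -mulmxA [in RHS]mxE; apply: eq_bigr => j _.
  by rewrite [row _ _ _ _]mxE [col _ _ _ _]mxE.
have trE (X : 'M[C]_m) : \tr X = \sum_i ip (e i) (X *m e i).
  under eq_bigr do rewrite eE.
  by rewrite -[RHS]/(\tr _) mxtrace_mulC mulmxA P'P mul1mx.
have ee i : ip (e i) (e i) = 1.
  by rewrite -[X in ip _ X]mul1mx eE mulmx1 PP mxE eqxx.
have PBP : P *m B *m adjmx P = diag_mx d.
  by rewrite Bd PE !mulmxA PP mul1mx -mulmxA PP mulmx1.
have dE i : ip (e i) (B *m e i) = d 0 i by rewrite eE PBP mxE eqxx.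
have d_ge0 i : 0 <= d 0 i by rewrite -dE /ip mulmxA.
have dR i : d 0 i = (complex.Re (d 0 i))%:C.
  by rewrite RRe_real // realE d_ge0.
have AA i : ip (A *m e i) (A *m e i) = ((complex.Re (d 0 i)) ^+ 2)%:C.
  rewrite ip_mulmxl mulmxA -BB eE.
  have -> : P *m (B *m B) *m adjmx P = (P *m B *m adjmx P) *m (P *m B *m adjmx P).
    by rewrite !mulmxA -(mulmxA (P *m B) (adjmx P)) P'P mulmx1.
  rewrite PBP mul_diag_mx !mxE eqxx mulr1n.
  by rewrite rmorphXn /= -dR expr2.
have -> : t = \sum_i complex.Re (d 0 i).
  have := congr1 (@complex.Re R) trB; rewrite trE Re_sum /= => <-.
  by apply: eq_bigr => i _; rewrite dE.
rewrite trE Re_sum ler_sum // => i _.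
rewrite -mulmxA -[in X in ip _ X]Mh -ip_mulmxl.
apply: Re_ip_le (AA i); first exact: Re_ge0.
by rewrite (le_trans (contraction_of_cube _ Mh M3)) // ee.
Qed.
End Adjoint.

Section Effects.
Set Implicit Arguments.
Unset Strict Implicit.
Variable R : realType.
Local Notation C := R[i].

Definition sqmod (z : C) : R := complex.Re z ^+ 2 + complex.Im z ^+ 2.

Lemma sqmodE (z : C) : (sqmod z)%:C = z^*%R * z.
Proof. by rewrite /sqmod add_Re2_Im2 normCK mulrC. Qed.

Lemma sqmod_ge0 (z : C) : 0 <= sqmod z.
Proof. by rewrite addr_ge0 ?sqr_ge0. Qed.

Lemma sqmodM (y z : C) : sqmod (y * z) = sqmod y * sqmod z.
Proof. by case: y z => [a b] [c d]; rewrite /sqmod /=; ring. Qed.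

Lemma sqmod_real (a : R) : sqmod a%:C = a ^+ 2.
Proof. by rewrite /sqmod /= expr0n addr0. Qed.

Lemma phase_to_modulus (z : C) :
  exists2 ph : C, ph^*%R * ph = 1 & ph * z = (Num.sqrt (sqmod z))%:C.
Proof.
have nE : `|z| = (Num.sqrt (sqmod z))%:C by rewrite normc_def.
have [->|z0] := eqVneq z 0.
  by exists 1; rewrite ?rmorph1 ?mulr1 // mulr0 /sqmod /= expr0n addr0 sqrtr0.
have n0 : `|z| != 0 by rewrite normr_eq0.
exists (`|z| / z); last by rewrite divfK.
rewrite rmorphM fmorphV /= conj_normC mulrACA -invfM -expr2 (mulrC z^*%R) -normCK.
by rewrite mulfV // expf_neq0.
Qed.

Lemma qpsd_Re_ge0 m (A : 'M[C]_m) x : qpsd A -> 0 <= complex.Re (ip x (A *m x)).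
Proof. by move=> [_ Apos]; apply: Re_ge0; rewrite /ip mulmxA. Qed.

Lemma Re_ip_quadratic m (A : 'M[C]_m) u v (a b : R) :
  complex.Re (ip (a%:C *: u - b%:C *: v) (A *m (a%:C *: u - b%:C *: v))) =
  a ^+ 2 * complex.Re (ip u (A *m u)) + b ^+ 2 * complex.Re (ip v (A *m v))
  - a * b * (complex.Re (ip u (A *m v)) + complex.Re (ip v (A *m u))).
Proof.
rewrite mulmxBr -!scalemxAr ipBl !ipBr !ipZl !ipZr !conjC_real !ReB !ReZ; ring.
Qed.

Lemma qeffect_Re_le m (mu : 'M[C]_m) x : qeffect mu ->
  complex.Re (ip x (mu *m x)) <= complex.Re (ip x x).
Proof.
move=> [_ mu1]; have := qpsd_Re_ge0 x mu1.
by rewrite mulmxBl mul1mx ipBr ReB subr_ge0.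
Qed.

(* Effects are tested on (l + 1) u - (l - 1) v and (l - 1) u - (l + 1) v, in whose
   difference the cross terms cancel; l = 2 (1 + c) turns the sharp bound
   sqrt (1 - c^2) into its AM-GM majorant (1 - c^2) + 1/4. *)
Lemma effect_gap_real m (mu : 'M[C]_m) u v (c : R) : qeffect mu ->
  ip u u = 1 -> ip v v = 1 -> ip u v = c%:C -> 0 <= c ->
  complex.Re (ip u (mu *m u)) - complex.Re (ip v (mu *m v)) <= 1 - c ^+ 2 + 1 / 4.
Proof.
move=> muE uu vv uv c0; pose l := 2 * (1 + c).
have l0 : 0 < l by rewrite /l; lra.
have vu : ip v u = c%:C by rewrite -ip_conj uv conjC_real.
have quad1 (a b : R) : complex.Re (ip (a%:C *: u - b%:C *: v) (a%:C *: u - b%:C *: v))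
    = a ^+ 2 + b ^+ 2 - a * b * (c + c).
  have := Re_ip_quadratic 1%:M u v a b; rewrite !mul1mx uu vv uv vu => ->.
  by rewrite !mulr1.
have h1 := qeffect_Re_le ((l + 1)%:C *: u - (l - 1)%:C *: v) muE.
have h0 := qpsd_Re_ge0 ((l - 1)%:C *: u - (l + 1)%:C *: v) muE.1.
rewrite Re_ip_quadratic quad1 in h1; rewrite Re_ip_quadratic in h0.
have lE : 2 * l ^+ 2 + 2 - 2 * (l ^+ 2 - 1) * c = 4 * (l * (1 - c ^+ 2 + 1 / 4)).
  by rewrite /l; field.
move: h1 h0; set hu := complex.Re (ip u _); set hv := complex.Re (ip v _).
set k := (complex.Re _ + _); move: hu hv k => hu hv k h1 h0.
by rewrite -(ler_pM2l l0); lra.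
Qed.

Lemma effect_gap m (mu : 'M[C]_m) u v : qeffect mu -> ip u u = 1 -> ip v v = 1 ->
  complex.Re (ip u (mu *m u)) - complex.Re (ip v (mu *m v))
    <= 1 - sqmod (ip u v) + 1 / 4.
Proof.
move=> muE uu vv; have [ph ph1 phE] := phase_to_modulus (ip u v).
have := @effect_gap_real _ mu u (ph *: v) _ muE uu _ _ (sqrtr_ge0 (sqmod (ip u v))).
rewrite -scalemxAr !(ipZl, ipZr) vv mulr1 ph1 mulrA ph1 mul1r phE sqr_sqrtr ?sqmod_ge0 //.
exact.
Qed.

Lemma effect_prob m (mu : 'M[C]_m) u : qeffect mu -> ip u u = 1 ->
  0 <= complex.Re (ip u (mu *m u)) <= 1.
Proof.
move=> muE uu; have := qeffect_Re_le u muE; rewrite uu => ->.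
by rewrite qpsd_Re_ge0 //; case: muE.
Qed.

Lemma mxtrace_tens m n (A : 'M[C]_m) (B : 'M[C]_n) : \tr (A *t B) = \tr A * \tr B.
Proof. by rewrite /mxtrace mulr_sum; apply: eq_bigr => i _; rewrite mxE. Qed.

Lemma ntens_mul a b c (f : nat -> 'M[C]_(a, b)) (g : nat -> 'M[C]_(b, c)) n :
  ntens f n *m ntens g n = ntens (fun j => f j *m g j) n.
Proof.
case: n => [|n] /=; first by rewrite mulmx1.
elim: n f g => [//|n IHn] f g /=.
by rewrite tensmx_mul IHn.
Qed.

Lemma adj_ntens a b (f : nat -> 'M[C]_(a, b)) n :
  adjmx (ntens f n) = ntens (fun j => adjmx (f j)) n.
Proof.
case: n => [|n] /=; first by rewrite adjmx1.
elim: n f => [//|n IHn] f /=.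
by rewrite adjmx_tens IHn.
Qed.

Lemma mxtrace_ntens a (f : nat -> 'M[C]_a) n :
  \tr (ntens f n) = \prod_(j < n) \tr (f j).
Proof.
case: n => [|n] /=; first by rewrite big_ord0 mxtrace1.
elim: n f => [|n IHn] f /=; first by rewrite big_ord1.
by rewrite mxtrace_tens IHn [RHS]big_ord_recl.
Qed.

Lemma ip_castmx m p (e : p = 1%N) (X Y : 'M[C]_(m, p)) :
  ip (castmx (erefl m, e) X) (castmx (erefl m, e) Y) = \tr (adjmx X *m Y).
Proof. by subst p; rewrite !castmx_id /ip /mxtrace big_ord1. Qed.

Lemma ketbra_castmx m p (e : p = 1%N) (X : 'M[C]_(m, p)) :
  ketbra (castmx (erefl m, e) X) = X *m adjmx X.
Proof. by subst p; rewrite castmx_id. Qed.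

Lemma ip_ntensv m (u v : nat -> 'cV[C]_m) n :
  ip (ntensv u n) (ntensv v n) = \prod_(j < n) ip (u j) (v j).
Proof.
rewrite /ntensv ip_castmx adj_ntens ntens_mul mxtrace_ntens.
by apply: eq_bigr => j _; rewrite /mxtrace big_ord1.
Qed.

Lemma ntens_ketbra m (u : nat -> 'cV[C]_m) n :
  ntens (fun j => ketbra (u j)) n = ketbra (ntensv u n).
Proof. by rewrite /ntensv ketbra_castmx adj_ntens ntens_mul. Qed.

Definition is_projector m (Q : 'M[C]_m) := adjmx Q = Q /\ Q *m Q = Q.

Lemma tens_proj m n (Q : 'M[C]_n) : is_projector Q ->
  is_projector ((1%:M : 'M[C]_m) *t Q).
Proof.
by move=> [Qh QQ]; split; rewrite ?adjmx_tens ?adjmx1 ?Qh // tensmx_mul mulmx1 QQ.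
Qed.

Lemma tens1_addZ m n (c : C) (Q : 'M[C]_n) :
  (1%:M : 'M[C]_m) *t (1%:M + c *: Q) = 1%:M + c *: (1%:M *t Q).
Proof.
apply/matrixP => i j.
case: (mxtens_indexP i) => i0 i1; case: (mxtens_indexP j) => j0 j1.
rewrite !mxE !mxtens_indexK /= mulrDr mulrCA; congr (_ + _).
by rewrite -natrM mulnb (inj_eq (can_inj (@mxtens_indexK m n))) xpair_eqE.
Qed.

Lemma Aatt_projector k a : (0 < k)%N ->
  exists2 Q : 'M[C]_(2 ^ k), is_projector Q & Aatt k a = 1%:M + (expi a - 1) *: Q.
Proof.
case: k => // k _; rewrite /Aatt /=; elim: k => [|k [Q Qp IHk]] /=.
  exists (delta_mx 1 1); first split.
  - by apply/matrixP => i j; rewrite adjmxE !mxE andbC rmorph_nat.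
  - by rewrite mul_delta_mx.
  apply/matrixP => i j; rewrite !mxE.
  case: i j => [[|[|//]] ?] [[|[|//]] ?] //=;
    by rewrite ?(mulr0, addr0) // mulr1 addrC subrK.
exists (1%:M *t Q); first exact: tens_proj.
by rewrite [X in _ *t X]IHk tens1_addZ.
Qed.

Lemma phase_projector_unitary m (Q : 'M[C]_m) a : is_projector Q ->
  qunitary (1%:M + (expi a - 1) *: Q).
Proof.
move=> [Qh QQ]; rewrite /qunitary adjmxD adjmxZ adjmx1 Qh.
rewrite mulmxDl !mulmxDr !mul1mx !mulmx1 -!scalemxAl -!scalemxAr QQ scalerA.
rewrite -addrA -!scalerDl -[RHS]addr0 -(scale0r Q); congr (_ + _ *: _).
apply/eqP; rewrite eq_complex /expi /=; apply/andP; split; apply/eqP.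
  by have := cos2Dsin2 a; nra.
by ring.
Qed.

Lemma phase_projector_overlap m (Q : 'M[C]_m) a x : is_projector Q -> ip x x = 1 ->
  1 - (1 - cos a) / 2 <= sqmod (ip x ((1%:M + (expi a - 1) *: Q) *m x)).
Proof.
move=> [Qh QQ] xx.
have qE : ip x (Q *m x) = ip (Q *m x) (Q *m x) by rewrite ip_mulmxl Qh mulmxA QQ.
have q0 : 0 <= ip x (Q *m x) by rewrite qE ip_ge0.
have q1 : 0 <= 1 - ip x (Q *m x).
  have := ip_ge0 (x - Q *m x); rewrite !(ipBl, ipBr) -qE ip_mulmxl Qh xx.
  by rewrite subrr subr0.
rewrite mulmxDl mul1mx -scalemxAl ipDr ipZr xx.
move: q0 q1; case: (ip x (Q *m x)) => p r; rewrite !lecE /= => /andP[/eqP-> p0].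
move=> /andP[_ p1]; rewrite /sqmod /expi /=.
have := cos2Dsin2 a; have := cos_le1 a.
rewrite -subr_ge0 => c1 cs.
have := mulr_ge0 c1 (sqr_ge0 (1 - 2 * p)).
by nra.
Qed.

End Effects.

Section Discrimination.
Set Implicit Arguments.
Unset Strict Implicit.
Variable R : realType.
Local Notation C := R[i].

Definition retr m (A B : 'M[C]_m) : R := complex.Re (\tr (A *m B)).

Lemma retrDl m (A B D : 'M[C]_m) : retr (A + B) D = retr A D + retr B D.
Proof. by rewrite /retr mulmxDl mxtraceD ReD. Qed.

Lemma retrDr m (A B D : 'M[C]_m) : retr A (B + D) = retr A B + retr A D.
Proof. by rewrite /retr mulmxDr mxtraceD ReD. Qed.

Lemma retrBl m (A B D : 'M[C]_m) : retr (A - B) D = retr A D - retr B D.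
Proof. by rewrite /retr mulmxBl raddfB ReB. Qed.

Lemma retrBr m (A B D : 'M[C]_m) : retr A (B - D) = retr A B - retr A D.
Proof. by rewrite /retr mulmxBr raddfB ReB. Qed.

Lemma retrZl m (a : R) (A B : 'M[C]_m) : retr (a%:C *: A) B = a * retr A B.
Proof. by rewrite /retr -scalemxAl mxtraceZ ReZ. Qed.

Lemma retrZr m (a : R) (A B : 'M[C]_m) : retr A (a%:C *: B) = a * retr A B.
Proof. by rewrite /retr -scalemxAr mxtraceZ ReZ. Qed.

Lemma ketbra_herm m (x : 'cV[C]_m) : adjmx (ketbra x) = ketbra x.
Proof. by rewrite /ketbra adjmxM adjmxK. Qed.

Lemma retr_ketbra m (x y : 'cV[C]_m) : retr (ketbra x) (ketbra y) = sqmod (ip x y).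
Proof.
rewrite /retr ketbra_mul mxtraceZ mxtrace_mulC.
have -> : \tr (adjmx y *m x) = (ip x y)^*%R by rewrite ip_conj /mxtrace big_ord1.
by rewrite mulrC -sqmodE.
Qed.

Lemma ketbra_mul3 m (x y : 'cV[C]_m) :
  ketbra x *m ketbra y *m ketbra x = (sqmod (ip x y))%:C *: ketbra x.
Proof.
rewrite ketbra_mul -scalemxAl -mulmxA /ketbra (mulmxA (adjmx y)).
rewrite [adjmx y *m x]mx11_scalar -/(ip y x) mul_scalar_mx -scalemxAr scalerA.
by rewrite sqmodE ip_conj mulrC.
Qed.

Lemma ketbra_idem m (x : 'cV[C]_m) : ip x x = 1 -> ketbra x *m ketbra x = ketbra x.
Proof. by move=> xx; rewrite ketbra_mul xx scale1r. Qed.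

Lemma ketbra_orth m (x y : 'cV[C]_m) : ip x y = 0 -> ketbra x *m ketbra y = 0.
Proof. by move=> xy; rewrite ketbra_mul xy scale0r. Qed.

Lemma sqmod_ipC m (x y : 'cV[C]_m) : sqmod (ip y x) = sqmod (ip x y).
Proof. by rewrite -(ip_conj x y) /sqmod; case: (ip x y) => a b /=; rewrite sqrrN. Qed.

Lemma ketbra_mul_diff_sqr m (x y : 'cV[C]_m) : ip x x = 1 -> ip y y = 1 ->
  ketbra x *m (ketbra x - ketbra y) *m (ketbra x - ketbra y) =
  (1 - sqmod (ip x y))%:C *: ketbra x.
Proof.
move=> xx yy; rewrite (mulmxBr (ketbra x)) ketbra_idem // mulmxBl !mulmxBr ketbra_idem //.
rewrite ketbra_mul3 -mulmxA ketbra_idem // rmorphB rmorph1 scalerBl scale1r.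
by rewrite opprB addrA subrK.
Qed.

Lemma ketbra_diff_cube m (x y : 'cV[C]_m) : ip x x = 1 -> ip y y = 1 ->
  (ketbra x - ketbra y) *m (ketbra x - ketbra y) *m (ketbra x - ketbra y) =
  (1 - sqmod (ip x y))%:C *: (ketbra x - ketbra y).
Proof.
move=> xx yy; rewrite {1}mulmxBl [LHS]mulmxBl ketbra_mul_diff_sqr //.
have := ketbra_mul_diff_sqr yy xx; rewrite -(opprB (ketbra x)) !(mulmxN, mulNmx).
by rewrite opprK sqmod_ipC => ->; rewrite scalerBr.
Qed.

Lemma orthogonal_sum_cube m (D E : 'M[C]_m) (r e c : R) :
  D *m E = 0 -> E *m D = 0 -> E *m E = E -> D *m D *m D = c%:C *: D ->
  r ^+ 2 * c = 1 -> e ^+ 2 = 1 ->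
  let M := r%:C *: D + e%:C *: E in M *m M *m M = M.
Proof.
move=> DE ED EE DDD rc ee M.
have MM : M *m M = (r ^+ 2)%:C *: (D *m D) + E.
  rewrite /M mulmxDl !mulmxDr -!scalemxAl -!scalemxAr DE ED EE !scaler0.
  by rewrite addr0 add0r !scalerA -!rmorphM /= -!expr2 ee scale1r.
rewrite MM mulmxDl !mulmxDr -!scalemxAl -!scalemxAr DDD -(mulmxA D) DE mulmx0 ED EE.
rewrite !scaler0 addr0 add0r !scalerA -!rmorphM /=.
by congr (_%:C *: _ + _); rewrite mulrAC rc mul1r.
Qed.

Lemma trace_dist_le_dual m (rho sigma D E : 'M[C]_m) (r e c eps : R) :
  trace_dist_le rho sigma eps -> adjmx D = D -> adjmx E = E ->
  D *m E = 0 -> E *m D = 0 -> E *m E = E -> D *m D *m D = c%:C *: D ->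
  r ^+ 2 * c = 1 -> e ^+ 2 = 1 ->
  r * retr D (rho - sigma) + e * retr E (rho - sigma) <= 2 * eps.
Proof.
move=> [t [tn teps]] Dh Eh DE ED EE DDD rc ee.
have := qtrace_norm_dual tn _ (orthogonal_sum_cube DE ED EE DDD rc ee).
rewrite adjmxD !adjmxZ Dh Eh !conjC_real => /(_ erefl).
rewrite -/(retr _ _) retrDl !retrZl => h; apply: le_trans h _.
by rewrite mulrC -ler_pdivrMr.
Qed.

Lemma flagged_state_correct m (f bt : 'cV[C]_m) (p eps : R) :
  ip f f = 1 -> ip bt bt = 1 -> ip f bt = 0 ->
  trace_dist_le (p%:C *: ketbra f + (1 - p)%:C *: ketbra bt) (ketbra f) eps ->
  1 - p <= eps.
Proof.
move=> ff bb fb /trace_dist_le_dual tdl.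
have bf : ip bt f = 0 by rewrite -ip_conj fb rmorph0.
have := tdl (ketbra f) (ketbra bt) (-1) 1 1; rewrite !ketbra_herm.
rewrite (ketbra_orth fb) (ketbra_orth bf) !ketbra_idem // scale1r.
move=> /(_ erefl erefl erefl erefl erefl erefl).
rewrite !retrBr !retrDr !retrZr !retr_ketbra ff bb fb bf.
rewrite -[0 : C]/((0 : R)%:C) -[1 : C]/((1 : R)%:C) !sqmod_real => h.
have N1sq : (-1) ^+ 2 * 1 = 1 :> R by rewrite sqrrN expr1n mulr1.
by have := h N1sq (expr1n _ _); rewrite expr0n expr1n /=; lra.
Qed.

(* The bottom flag may be weighted by either sign; averaging the two tests with
   weights (1 - s) / 2 and (1 + s) / 2 eliminates the simulator's parameter p. *)
Lemma flagged_state_secure m (f g bt : 'cV[C]_m) (pd p s eps : R) :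
  ip f f = 1 -> ip g g = 1 -> ip bt bt = 1 -> ip f bt = 0 -> ip g bt = 0 ->
  sqmod (ip g f) = 1 - s ^+ 2 -> 0 < s <= 1 ->
  trace_dist_le (pd%:C *: ketbra g + (1 - pd)%:C *: ketbra bt)
    (p%:C *: ketbra f + (1 - p)%:C *: ketbra bt) eps ->
  s * pd <= eps.
Proof.
move=> ff gg bb fb gb gf /andP[s0 s1] tdl.
have bf : ip bt f = 0 by rewrite -ip_conj fb rmorph0.
have bg : ip bt g = 0 by rewrite -ip_conj gb rmorph0.
have fg : sqmod (ip f g) = 1 - s ^+ 2.
  by rewrite sqmod_ipC.
have s_neq0 : s != 0 by rewrite gt_eqF.
have test e : e ^+ 2 = 1 -> s * (pd + p) + e * (p - pd) <= 2 * eps.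
  move=> ee; have := trace_dist_le_dual (D := ketbra g - ketbra f) (E := ketbra bt)
    (r := s^-1) (e := e) (c := s ^+ 2) tdl.
  rewrite adjmxB !ketbra_herm mulmxBl mulmxBr.
  rewrite (ketbra_orth fb) (ketbra_orth bf) (ketbra_orth gb) (ketbra_orth bg) subrr.
  rewrite (ketbra_idem bb) ketbra_diff_cube // gf.
  have -> : 1 - (1 - s ^+ 2) = s ^+ 2 by ring.
  move=> /(_ erefl erefl erefl erefl erefl erefl) h.
  apply: le_trans (h _ ee); last by rewrite exprVn mulVf // expf_neq0.
  rewrite !retrBl !retrBr !retrDr !retrZr !retr_ketbra ff gg bb fb gb bf bg gf fg.
  rewrite -[0 : C]/((0 : R)%:C) -[1 : C]/((1 : R)%:C) !sqmod_real expr0n expr1n /=.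
  rewrite le_eqVlt; apply/orP; left; apply/eqP; field.
  exact: s_neq0.
have t1 := test 1 (expr1n _ _).
have t2 : s * (pd + p) + (-1) * (p - pd) <= 2 * eps by apply: test; rewrite sqrrN expr1n.
by nra.
Qed.

End Discrimination.

Section PhaseAttack.
Set Implicit Arguments.
Unset Strict Implicit.
Variable R : realType.
Local Notation C := R[i].

Lemma ip_unitary m (U : 'M[C]_m) x y : qunitary U -> ip (U *m x) (U *m y) = ip x y.
Proof. by move=> UU; rewrite ip_mulmxl mulmxA UU mul1mx. Qed.

Lemma attacked_unitary k b a (U : 'M[C]_(2 ^ k)) : (0 < k)%N -> qunitary U ->
  qunitary (attacked b a U).
Proof.
move=> k0 UU; have [Q Qp AE] := Aatt_projector a k0.
have AA : qunitary (Aatt k a) by rewrite AE; exact: phase_projector_unitary.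
rewrite /attacked /qunitary; case: b; rewrite adjmxM mulmxA -(mulmxA (adjmx _)).
  by rewrite UU mulmx1 AA.
by rewrite AA mulmx1 UU.
Qed.

Lemma attacked_overlap k b a (U : 'M[C]_(2 ^ k)) x : (0 < k)%N -> qunitary U ->
  ip x x = 1 -> 1 - (1 - cos a) / 2 <= sqmod (ip (U *m x) (attacked b a U *m x)).
Proof.
move=> k0 UU xx; have [Q Qp AE] := Aatt_projector a k0.
rewrite /attacked; case: b; rewrite -mulmxA ?ip_unitary // AE.
  exact: phase_projector_overlap.
by apply: phase_projector_overlap => //; rewrite ip_unitary.
Qed.

Lemma prod_ge_1B (F : nat -> R) (s : R) n : 0 <= s <= 1 ->
  (forall j, (j < n)%N -> 1 - s <= F j) -> 1 - n%:R * s <= \prod_(j < n) F j.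
Proof.
move=> /andP[s0 s1]; elim: n => [|n IHn] Fge; first by rewrite big_ord0 mul0r subr0.
rewrite big_ord_recr /=.
have Pn : 1 - n%:R * s <= \prod_(i < n) F i by apply: IHn => j jn; apply/Fge/ltnW.
have P0 : 0 <= \prod_(i < n) F i.
  apply: prodr_ge0 => i _; apply: le_trans (Fge i _); rewrite ?subr_ge0 //.
  exact: leqW (ltn_ord i).
apply: le_trans (ler_wpM2l P0 (Fge n (ltnSn n))).
apply: le_trans (ler_wpM2r _ Pn); last by rewrite subr_ge0.
rewrite -natr1; have n0 : 0 <= n%:R :> R by [].
by have := mulr_ge0 n0 (sqr_ge0 s); lra.
Qed.

Lemma sqmod_prod n (F : 'I_n -> C) : sqmod (\prod_j F j) = \prod_j sqmod (F j).
Proof.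
elim/big_rec2: _ => [|i y z _ <-]; last by rewrite sqmodM.
by rewrite -[1 : C]/((1 : R)%:C) sqmod_real expr1n.
Qed.

Lemma bump_le l j n : (j < n)%N -> (bump l j <= n)%N.
Proof. by move=> jn; apply: leq_trans (leq_add (leq_b1 _) (leqnn j)) jn. Qed.

Section Acceptance.
Variables (k : nat) (V : nat -> nat -> 'M[C]_(2 ^ k)).
Variables (chi : nat -> nat -> 'cV[C]_(2 ^ k)) (mu : forall n, 'M[C]_((2 ^ k) ^ n)).
Hypothesis V_unitary : forall n i, (i <= n)%N -> qunitary (V n i).
Hypothesis chi_unit : forall n i, (i <= n)%N -> qunit_vec (chi n i).
Hypothesis mu_effect : forall n, qeffect (mu n).

Definition test_state (W : nat -> nat -> 'M[C]_(2 ^ k)) n l :=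
  ntensv (fun j => W n (bump l j) *m chi n (bump l j)) n.

Lemma paccE W n l : pacc W chi mu n l =
  complex.Re (ip (test_state W n l) (mu n *m test_state W n l)).
Proof. by rewrite /pacc ntens_ketbra mxtrace_mul_ketbra. Qed.

Lemma test_state_unit W n l : (forall n i, (i <= n)%N -> qunitary (W n i)) ->
  ip (test_state W n l) (test_state W n l) = 1.
Proof.
move=> Wu; rewrite ip_ntensv big1 // => j _.
rewrite ip_unitary; last exact/Wu/bump_le.
exact/qunit_vecP/chi_unit/bump_le.
Qed.

Lemma pacc_prob n l : 0 <= pacc V chi mu n l <= 1.
Proof. by rewrite paccE; apply: effect_prob => //; exact: test_state_unit. Qed.

Lemma pacc_attacked_gap b a n l : (0 < k)%N ->
  pacc V chi mu n l - pacc (fun n i => attacked b a (V n i)) chi mu n l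
    <= n%:R * ((1 - cos a) / 2) + 1 / 4.
Proof.
move=> k0; rewrite !paccE; apply: le_trans (effect_gap (mu_effect n) _ _) _.
- exact: test_state_unit.
- by apply: test_state_unit => m i im; apply/attacked_unitary/V_unitary.
rewrite ip_ntensv sqmod_prod.
pose F j := sqmod (ip (V n (bump l j) *m chi n (bump l j))
  (attacked b a (V n (bump l j)) *m chi n (bump l j))).
suff : 1 - n%:R * ((1 - cos a) / 2) <= \prod_(j < n) F j by rewrite /F; lra.
apply: prod_ge_1B => [|j jn].
  by have := cos_le1 a; have := cos_geN1 a; lra.
apply: attacked_overlap => //; first exact/V_unitary/bump_le.
exact/qunit_vecP/chi_unit/bump_le.
Qed.

End Acceptance.

Section Average.
Variables (k : nat) (chi : nat -> nat -> 'cV[C]_(2 ^ k)).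
Variables (mu : forall n, 'M[C]_((2 ^ k) ^ n)) (Omega : nat -> R) (N : R).
Hypothesis Omega_ge0 : forall n, 0 <= Omega n.
Hypothesis Omega_sum : series Omega @ \oo --> (1 : R).
Hypothesis Omega_mean : series (fun n : nat => n%:R * Omega n) @ \oo --> N.

Definition pavg_term V n : R :=
  Omega n / n.+1%:R * \sum_(l < n.+1) pacc V chi mu n l.

Lemma pavg_term_bounds V n : (forall n l, 0 <= pacc V chi mu n l <= 1) ->
  0 <= pavg_term V n <= Omega n.
Proof.
move=> V01; have w0 : 0 <= Omega n / n.+1%:R by rewrite divr_ge0.
rewrite mulr_ge0 ?sumr_ge0 //=; last by move=> l _; case/andP: (V01 n l).
rewrite -[leRHS](@divfK _ n.+1%:R) ?pnatr_eq0 // ler_wpM2l //.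
rewrite -[n.+1%:R]mulr1 -[n.+1 in leRHS]card_ord mulr_natl -sumr_const ler_sum // => l _.
by case/andP: (V01 n l).
Qed.

Lemma pavg_cvg V : (forall n l, 0 <= pacc V chi mu n l <= 1) ->
  series (pavg_term V) @ \oo --> pavg Omega V chi mu.
Proof.
move=> V01; apply: (@series_le_cvg _ _ Omega) => // [n|n|].
- by case/andP: (pavg_term_bounds n V01).
- by case/andP: (pavg_term_bounds n V01).
by apply/cvg_ex; exists 1.
Qed.

Lemma pavg_gap V W (s : R) :
  (forall n l, 0 <= pacc V chi mu n l <= 1) ->
  (forall n l, 0 <= pacc W chi mu n l <= 1) ->
  (forall n l, pacc V chi mu n l - pacc W chi mu n l <= n%:R * s + 1 / 4) ->
  pavg Omega V chi mu <= pavg Omega W chi mu + (s * N + 1 / 4 * 1).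
Proof.
move=> V01 W01 gap.
apply: (ler_cvg_to (pavg_cvg V01)
  (cvgD (pavg_cvg W01) (cvgD (cvgMl_tmp (a := s) Omega_mean)
                             (cvgMl_tmp (a := 1 / 4) Omega_sum)))).
apply: nearW => m; rewrite !fctE /series /= !mulr_sumr -!big_split /=.
apply: ler_sum => n _; rewrite /pavg_term -lerBlDl -mulrBr -sumrB.
have w0 : 0 <= Omega n / n.+1%:R by rewrite divr_ge0.
apply: (@le_trans _ _ (Omega n / n.+1%:R * \sum_(l < n.+1) (n%:R * s + 1 / 4))).
  by rewrite ler_wpM2l // ler_sum.
rewrite sumr_const card_ord -(mulr_natl (_ + _)) mulrA divfK ?pnatr_eq0 //; lra.
Qed.

End Average.
End PhaseAttack.

Section PlusStates.
Set Implicit Arguments.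
Unset Strict Implicit.
Variable R : realType.
Local Notation C := R[i].

Lemma ip_embX k (x y : 'cV[C]_(2 ^ k)) : ip (embX x) (embX y) = ip x y.
Proof.
rewrite /ip /embX /adjmx map_col_mx tr_col_mx mul_row_col.
by rewrite mulmx0 addr0.
Qed.

Lemma ip_embX_ketbot k (x : 'cV[C]_(2 ^ k)) : ip (embX x) (@ketbot R k) = 0.
Proof.
rewrite /ip /embX /ketbot /adjmx map_col_mx tr_col_mx mul_row_col.
by rewrite mulmx0 add0r map_mx0 trmx0 mul0mx mxE.
Qed.

Lemma ip_ketbot k : ip (@ketbot R k) (@ketbot R k) = 1.
Proof.
rewrite /ip /ketbot /adjmx map_col_mx tr_col_mx mul_row_col mulmx0 add0r mulmx1.
by rewrite map_mx1 trmx1 mxE.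
Qed.

Lemma sqrt_half_sqr : (Num.sqrt (2^-1 : R))%:C * (Num.sqrt (2^-1 : R))%:C = (2^-1 : R)%:C.
Proof. by rewrite -rmorphM /= -expr2 sqr_sqrtr // invr_ge0. Qed.

Lemma ip_ketplus : ip ketplus ketplus = 1 :> C.
Proof.
rewrite /ip mxE !big_ord_recl big_ord0 !adjmxE !mxE conjC_real sqrt_half_sqr addr0.
by rewrite -rmorphD /=; congr _%:C; lra.
Qed.

Lemma ip_ketplusa a : ip (ketplusa a) (ketplusa a) = 1 :> C.
Proof.
rewrite /ip mxE !big_ord_recl big_ord0 !adjmxE !mxE /= !mulr1 !rmorphM /= !conjC_real.
have w1 : (expi a)^*%R * expi a = 1 by rewrite -sqmodE /sqmod /= cos2Dsin2.
rewrite mulrACA sqrt_half_sqr addr0 w1 mulr1 -rmorphD /=.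
by congr _%:C; lra.
Qed.

Lemma sqmod_ketplusa a : sqmod (ip (ketplusa a) ketplus) = 1 - (1 - cos a) / 2 :> R.
Proof.
rewrite sqmod_ipC /ip mxE !big_ord_recl big_ord0 !adjmxE !mxE /= !mulr1 conjC_real.
rewrite mulrA sqrt_half_sqr addr0 /sqmod /expi /=.
by have := cos2Dsin2 a; nra.
Qed.

Lemma ip_plusk k : ip (plusk k) (plusk k) = 1 :> C.
Proof. by rewrite ip_ntensv big1 // => j _; rewrite ip_ketplus. Qed.

Lemma ip_plusk_a k a : ip (plusk_a k a) (plusk_a k a) = 1 :> C.
Proof.
by rewrite ip_ntensv big1 // => j _; case: eqP; rewrite ?ip_ketplusa ?ip_ketplus.
Qed.

Lemma sqmod_plusk_a k a : (0 < k)%N ->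
  sqmod (ip (plusk_a k a) (plusk k)) = 1 - (1 - cos a) / 2 :> R.
Proof.
case: k => // k _; rewrite ip_ntensv big_ord_recr /= eqxx big1 ?mul1r.
  exact: sqmod_ketplusa.
by move=> j _; rewrite ltn_eqF // ip_ketplus.
Qed.

End PlusStates.
(* Rounds are 0-based (see Defs.v); b fixes the attack placement:
   b = true : T^alpha = T A_alpha,  b = false : T^alpha = A_alpha T. *)
Theorem theorem2 (R : realType) (k : nat) (hk : (1 <= k)%N)
  (Omega : nat -> R) (N : R)
  (HOmega_ge0 : forall n, 0 <= Omega n)
  (HOmega_sum : series Omega @ \oo --> (1 : R))
  (HOmega_mean : series (fun n : nat => n%:R * Omega n) @ \oo --> N)
  (HN : 1 <= N)
  (T : nat -> nat -> 'M[R[i]]_(2 ^ k))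
  (chi : nat -> nat -> 'cV[R[i]]_(2 ^ k))
  (mu : forall n : nat, 'M[R[i]]_((2 ^ k) ^ n))
  (HT : forall n i : nat, (i <= n)%N -> qunitary (T n i))
  (Hchi : forall n i : nat, (i <= n)%N -> qunit_vec (chi n i))
  (Hmu : forall n : nat, qeffect (mu n))
  (b : bool) (epsH epsD : R) (HepsH : 0 <= epsH) (HepsD : 0 <= epsD)
  (Hcorrect : trace_dist_le (rhoH k (pH Omega T chi mu))
                            (ketbra (embX (plusk k))) epsH)
  (Hsecure : forall alpha : R, exists p : R, 0 <= p <= 1 /\
      trace_dist_le (rhoD k (pD Omega T chi mu b alpha) alpha)
        (p%:C *: ketbra (embX (plusk k)) + (1 - p)%:C *: ketbra (@ketbot R k))
        epsD) :
  1 / (4 * Num.sqrt N) <= epsH + epsD.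
Proof.
have N0 : 0 < N by lra.
have r0 : 0 < Num.sqrt N by rewrite sqrtr_gt0.
have r1 : 1 <= Num.sqrt N by rewrite -[leLHS]sqrtr1 ler_wsqrtr.
pose s := (2 * Num.sqrt N)^-1.
have s0 : 0 < s by rewrite invr_gt0 mulr_gt0.
have s_le : s <= 1 / 2.
  by rewrite div1r lef_pV2 ?posrE ?mulr_gt0 // ler_peMr.
have sN : s ^+ 2 * N = 1 / 4.
  rewrite -[in LHS](sqr_sqrtr (ltW N0)) -exprMn /s invfM -mulrA mulVf ?gt_eqF //.
  by field.
pose a := acos (1 - 2 * s ^+ 2).
have cosa : (1 - cos a) / 2 = s ^+ 2.
  rewrite /a acosK; first by field.
  by rewrite in_itv /=; apply/andP; split; nra.
have prH := pacc_prob HT Hchi Hmu.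
have prD := pacc_prob (fun n i im => attacked_unitary b a hk (HT n i im)) Hchi Hmu.
have gap : pH Omega T chi mu <= pD Omega T chi mu b a + (s ^+ 2 * N + 1 / 4 * 1).
  apply: (pavg_gap HOmega_ge0 HOmega_sum HOmega_mean prH prD) => n l.
  by rewrite -cosa; exact: pacc_attacked_gap.
have correct := flagged_state_correct _ (ip_ketbot _ _) (ip_embX_ketbot _) Hcorrect.
rewrite ip_embX ip_plusk in correct; have {}correct := correct erefl.
have [p [_ Hp]] := Hsecure a.
have secure : s * pD Omega T chi mu b a <= epsD.
  apply: flagged_state_secure Hp; rewrite ?ip_embX ?ip_ketbot ?ip_embX_ketbot //.
  - exact: ip_plusk.
  - exact: ip_plusk_a.
  - by rewrite sqmod_plusk_a // cosa.
  - by apply/andP; split; lra.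
have -> : 1 / (4 * Num.sqrt N) = s / 2 by rewrite /s; field; rewrite gt_eqF.
nra.
Qed.
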